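(* If we set $$\lambda_1=\frac{2\gamma_1}{n}\sqrt{\frac{T}{\rho_1}}\quad\text{and}\quad \lambda_2=\frac{2\gamma_2}{n}\sqrt{\frac{T}{\rho_2}},$$ then the algorithm DP-2S-GD (defined in the context) is $\rho$-zCDP, where $$\rho:=\rho_1+\rho_2=\frac{2T}{n^2}\left(\frac{\gamma_1^2}{\lambda_1^2}+\frac{\gamma_2^2}{\lambda_2^2}\right).$$
   Context: Two datasets are neighbors if they differ in exactly one entry; here a dataset consists of $n$ entries $(\mathbf z_i,\mathbf x_i,y_i)\in\mathbb R^q\times\mathbb R^p\times\mathbb R$. A randomized mechanism $M$ satisfies $\rho$-zero-concentrated differential privacy ($\rho$-zCDP) if for all neighboring datasets $D,D'$ and all $a>1$, $D_a(M(D)\,\|\,M(D'))\le\rho a$, where $D_a(P\|Q)=\frac1{a-1}\log\int\left(\frac{dP}{dQ}\right)^{a}dQ$ is the Rényi divergence of order $a$. Algorithm DP-2S-GD (target privacy budgets $\rho_1,\rho_2>0$, step sizes $\eta,\alpha>0$, noise scales $\lambda_1,\lambda_2>0$, clipping thresholds $\gamma_1,\gamma_2>0$, $T$ iterations): $\boldsymbol\Theta^{(0)}=\mathbf 0_{q\times p}$, $\boldsymbol\beta^{(0)}=\mathbf 0_p$; for $t=0,\dots,T-1$ draw fresh independent noise $\boldsymbol\Xi^{(t)}\in\mathbb R^{q\times p}$ with $\mathrm{vec}(\boldsymbol\Xi^{(t)})\sim\mathcal N(\mathbf 0,\lambda_1^2\mathbf I_q\otimes\mathbf I_p)$ and $\boldsymbol\nu^{(t)}\sim\mathcal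 N(\mathbf 0,\lambda_2^2\mathbf I_p)$, and set $$\boldsymbol\Theta^{(t+1)}=\boldsymbol\Theta^{(t)}-\tfrac{\eta}{n}\sum_{i=1}^n\mathrm{CLIP}_{\gamma_1}\big(\mathbf z_i(\mathbf z_i^\top\boldsymbol\Theta^{(t)}-\mathbf x_i^\top)\big)+\eta\boldsymbol\Xi^{(t)},$$ $$\boldsymbol\beta^{(t+1)}=\boldsymbol\beta^{(t)}-\tfrac{\alpha}{n}\sum_{i=1}^n\mathrm{CLIP}_{\gamma_2}\big(\boldsymbol\Theta^{(t)\top}\mathbf z_i(\mathbf z_i^\top\boldsymbol\Theta^{(t)}\boldsymbol\beta^{(t)}-y_i)\big)+\alpha\boldsymbol\nu^{(t)},$$ where $\mathrm{CLIP}_\gamma$ denotes per-sample clipping to norm at most $\gamma$. The output is $\{\boldsymbol\Theta^{(t)}\}_{t=1}^T,\{\boldsymbol\beta^{(t)}\}_{t=1}^T$.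
   Formalization: For the displayed λ₁, λ₂ the stated equality is off by a factor 2: ρ₁+ρ₂ equals twice (2T/n²)(γ₁²/λ₁²+γ₂²/λ₂²). The formal theorem proves zCDP with both quantities and states the corrected equality. *)

(* Defs.v *)
From HB Require Import structures.
From mathcomp Require Import all_boot all_order all_algebra.
From mathcomp Require Import all_classical all_reals all_analysis.
From mathcomp Require Import measurable_realfun.

Set Implicit Arguments.
Unset Strict Implicit.
Unset Printing Implicit Defensive.

Import Order.TTheory GRing.Theory Num.Theory.
Import numFieldNormedType.Exports.
Local Open Scope classical_set_scope.
Local Open Scope ring_scope.

(* Matrices carry the product sigma-algebra, generated by the entries; over a
   realType this is the Borel sigma-algebra. *)
Definition matrix_display : measure_display -> measure_display.
Proof. exact. Qed.

Section measurable_matrix.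
Context {d : measure_display} {T : measurableType d} (m n : nat).

Definition matrix_cylinders : set (set 'M[T]_(m, n)) :=
  \bigcup_(ij in [set: 'I_m * 'I_n])
    preimage_set_system setT (fun A : 'M[T]_(m, n) => A ij.1 ij.2) measurable.

Let matrix_set0 : <<s matrix_cylinders >> set0.
Proof. exact: sigma_algebra0. Qed.

Let matrix_setC (A : set 'M[T]_(m, n)) :
  <<s matrix_cylinders >> A -> <<s matrix_cylinders >> (~` A).
Proof. exact: sigma_algebraC. Qed.

Let matrix_bigcup (F : (set 'M[T]_(m, n))^nat) :
  (forall i, <<s matrix_cylinders >> (F i)) ->
  <<s matrix_cylinders >> (\bigcup_i F i).
Proof. exact: sigma_algebra_bigcup. Qed.

HB.instance Definition _ := @isMeasurable.Build (matrix_display d)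
  'M[T]_(m, n) <<s matrix_cylinders >> matrix_set0 matrix_setC matrix_bigcup.

End measurable_matrix.

Lemma measurable_fun_matrixP d d' (T1 : measurableType d)
    (T2 : measurableType d') (m n : nat) (f : T1 -> 'M[T2]_(m, n)) :
  measurable_fun setT f <->
  forall i j, measurable_fun setT (fun x => f x i j).
Proof.
split=> [mf i j|mf].
- move=> _ A mA; rewrite setTI.
  have -> : (fun x => f x i j) @^-1` A = f @^-1` [set M | A (M i j)] by [].
  rewrite -[X in measurable X]setTI; apply: mf => //.
  apply: sub_sigma_algebra; exists (i, j) => //; exists A => //.
  by rewrite setTI.
- apply: (@measurability _ _ _ _ _ _ (@matrix_cylinders _ T2 m n)) => //.
  move=> _ [_ [[i j] _ [A mA <-]] <-]; rewrite !setTI /=.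
  by have := mf i j measurableT A mA; rewrite setTI.
Qed.

Section privacy.
Context {R : realType}.

(* The divergence is +oo when P is not absolutely continuous w.r.t. Q. *)
Definition renyi_divergence d (T : measurableType d) (a : R)
    (P Q : probability T R) : \bar R :=
  if `[< P `<< Q >] then
    ((a - 1)^-1%:E *
      lne (\int[Q]_x (Radon_Nikodym (charge_of_finite_measure P) Q x) `^ a))%E
  else +oo%E.

Definition zCDP (X : Type) (neighbors : X -> X -> Prop)
    d (T : measurableType d) (M : X -> probability T R) (rho : R) : Prop :=
  forall D D' : X, neighbors D D' ->
  forall a : R, 1 < a -> (renyi_divergence a (M D) (M D') <= (rho * a)%:E)%E.

End privacy.

Definition neighbors (E : Type) (n : nat) (D D' : 'I_n -> E) : Prop :=
  exists i : 'I_n, D i <> D' i /\ forall j : 'I_n, j != i -> D j = D' j.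

Section probability.
Context {R : realType} {d : measure_display} {Omega : measurableType d}
  (P : probability Omega R).

Definition independent_events (I : finType) (E : I -> set Omega) : Prop :=
  forall J : {set I},
    P (\bigcap_(i in [set` J]) E i) = (\prod_(i in J) P (E i))%E.

(* vec X ~ N(0, s^2 I), i.e. the entries of X are independent N(0, s^2); note
   that the second parameter of [normal_prob] is the standard deviation. *)
Definition isotropic_gaussian (m n : nat) (s : R)
    (X : {RV P >-> 'M[R]_(m, n)}) : Prop :=
  (forall B : 'I_m * 'I_n -> set R, (forall ij, measurable (B ij)) ->
     independent_events (fun ij => (fun w => X w ij.1 ij.2) @^-1` B ij)) /\
  (forall i j (B : set R), measurable B ->
     P ((fun w => X w i j) @^-1` B) = normal_prob 0 s B).

Definition dp2sgd_noise (q p T : nat) (lambda1 lambda2 : R)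
    (Xi : nat -> {RV P >-> 'M[R]_(q, p)})
    (nu : nat -> {RV P >-> 'cV[R]_p}) : Prop :=
  [/\ forall t, (t < T)%N -> isotropic_gaussian lambda1 (Xi t),
      forall t, (t < T)%N -> isotropic_gaussian lambda2 (nu t) &
      forall (A : 'I_T -> set 'M[R]_(q, p)) (B : 'I_T -> set 'cV[R]_p),
        (forall t, measurable (A t)) -> (forall t, measurable (B t)) ->
        independent_events (fun k : 'I_T + 'I_T =>
          match k with
          | inl t => Xi t @^-1` A t
          | inr t => nu t @^-1` B t
          end)].

End probability.

Section algorithm.
Context {R : realType} (n q p : nat).

Record entry := Entry { zvec : 'cV[R]_q ; xvec : 'cV[R]_p ; yval : R }.

Definition dataset := 'I_n -> entry.

(* Frobenius norm (Euclidean norm on column vectors); the canonical norm of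
   the library on matrices is the max norm. *)
Definition frob (m k : nat) (A : 'M[R]_(m, k)) : R :=
  Num.sqrt (\sum_i \sum_j A i j ^+ 2).

(* CLIP_gamma(A) = min(1, gamma / |A|) A; at A = 0 the library's gamma / 0 = 0
   is harmless. *)
Definition clip (m k : nat) (gamma : R) (A : 'M[R]_(m, k)) : 'M[R]_(m, k) :=
  Num.min 1 (gamma / frob A) *: A.

Definition grad1 (Theta : 'M[R]_(q, p)) (e : entry) : 'M[R]_(q, p) :=
  zvec e *m ((zvec e)^T *m Theta - (xvec e)^T).

Definition grad2 (Theta : 'M[R]_(q, p)) (beta : 'cV[R]_p) (e : entry) :
    'cV[R]_p :=
  Theta^T *m zvec e *m ((zvec e)^T *m Theta *m beta - (yval e)%:M).

Context (eta alpha gamma1 gamma2 : R).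

Fixpoint dp2sgd_iter (D : dataset) (Xi : nat -> 'M[R]_(q, p))
    (nu : nat -> 'cV[R]_p) (t : nat) : 'M[R]_(q, p) * 'cV[R]_p :=
  match t with
  | 0%N => (0, 0)
  | t'.+1 =>
    let: (Theta, beta) := dp2sgd_iter D Xi nu t' in
    (Theta - (eta / n%:R) *: (\sum_i clip gamma1 (grad1 Theta (D i)))
       + eta *: Xi t',
     beta - (alpha / n%:R) *: (\sum_i clip gamma2 (grad2 Theta beta (D i)))
       + alpha *: nu t')
  end.

Definition dp2sgd (T : nat) (D : dataset) (Xi : nat -> 'M[R]_(q, p))
    (nu : nat -> 'cV[R]_p) : T.-tuple 'M[R]_(q, p) * T.-tuple 'cV[R]_p :=
  ([tuple (dp2sgd_iter D Xi nu t.+1).1 | t < T],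
   [tuple (dp2sgd_iter D Xi nu t.+1).2 | t < T]).

End algorithm.

Section measurability.
Context {R : realType} {d : measure_display} {Omega : measurableType d}.

Let mmx (m k : nat) (f : Omega -> 'M[R]_(m, k)) :=
  forall i j, measurable_fun setT (fun w => f w i j).

Let msum (I : Type) (r : seq I) (h : I -> Omega -> R) :
  (forall i, measurable_fun setT (h i)) ->
  measurable_fun setT (fun w => \sum_(i <- r) h i w).
Proof.
move=> mh; elim: r => [|i r IHr].
  by under eq_fun do rewrite big_nil; exact: measurable_cst.
by under eq_fun do rewrite big_cons; exact: measurable_funD.
Qed.

Let mmxD m k (f g : Omega -> 'M[R]_(m, k)) :
  mmx f -> mmx g -> mmx (fun w => f w + g w).
Proof.
move=> mf mg i j; under eq_fun do rewrite mxE.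
exact: measurable_funD.
Qed.

Let mmxZ m k (c : Omega -> R) (f : Omega -> 'M[R]_(m, k)) :
  measurable_fun setT c -> mmx f -> mmx (fun w => c w *: f w).
Proof.
move=> mc mf i j; under eq_fun do rewrite mxE.
exact: measurable_funM.
Qed.

Let mmxN m k (f : Omega -> 'M[R]_(m, k)) : mmx f -> mmx (fun w => - f w).
Proof.
move=> mf i j; under eq_fun do rewrite mxE.
exact: measurable_funN.
Qed.

Let mmx_cst m k (A : 'M[R]_(m, k)) : mmx (fun=> A).
Proof. by move=> i j; exact: measurable_cst. Qed.

Let mmxT m k (f : Omega -> 'M[R]_(m, k)) : mmx f -> mmx (fun w => (f w)^T).
Proof. by move=> mf i j; under eq_fun do rewrite mxE; exact: mf. Qed.

Let mmxM m k l (f : Omega -> 'M[R]_(m, k)) (g : Omega -> 'M[R]_(k, l)) :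
  mmx f -> mmx g -> mmx (fun w => f w *m g w).
Proof.
move=> mf mg i j; under eq_fun do rewrite mxE.
by apply: msum => h; exact: measurable_funM.
Qed.

Let mmx_sum m k (I : finType) (f : I -> Omega -> 'M[R]_(m, k)) :
  (forall i, mmx (f i)) -> mmx (fun w => \sum_i f i w).
Proof.
move=> mf i j; under eq_fun do rewrite summxE.
by apply: msum => h; exact: mf.
Qed.

Let mfrob m k (f : Omega -> 'M[R]_(m, k)) :
  mmx f -> measurable_fun setT (fun w => frob (f w)).
Proof.
move=> mf; apply: (measurableT_comp (f := @Num.sqrt R)).
  exact: continuous_measurable_fun (@sqrt_continuous R).
by apply: msum => i; apply: msum => j; exact: measurable_funX.
Qed.

Let mclip m k (c : R) (f : Omega -> 'M[R]_(m, k)) :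
  mmx f -> mmx (fun w => clip c (f w)).
Proof.
move=> mf; apply: mmxZ => //; apply: measurable_minr.
  exact: measurable_cst.
apply: measurable_funM; first exact: measurable_cst.
under eq_fun do rewrite -powR_inv1 ?sqrtr_ge0//.
by apply: (measurableT_comp (@measurable_powR R (-1))); exact: mfrob.
Qed.

Lemma measurable_dp2sgd (n q p : nat) (eta alpha gamma1 gamma2 : R) (T : nat)
    (D : @dataset R n q p)
    (Xi : nat -> {mfun Omega >-> 'M[R]_(q, p)})
    (nu : nat -> {mfun Omega >-> 'cV[R]_p}) :
  measurable_fun setT (fun w =>
    dp2sgd eta alpha gamma1 gamma2 T D (Xi ^~ w) (nu ^~ w)).
Proof.
pose S t w := dp2sgd_iter eta alpha gamma1 gamma2 D (Xi ^~ w) (nu ^~ w) t.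
have mS t : mmx (fun w => (S t w).1) /\ mmx (fun w => (S t w).2).
  elim: t => [|t [mTh mbe]]; first by split; exact: mmx_cst.
  have E1 w : (S t.+1 w).1 = (S t w).1 -
      (eta / n%:R) *: (\sum_i clip gamma1 (grad1 (S t w).1 (D i)))
      + eta *: Xi t w.
    by rewrite /S /=; case: dp2sgd_iter.
  have E2 w : (S t.+1 w).2 = (S t w).2 -
      (alpha / n%:R) *: (\sum_i clip gamma2 (grad2 (S t w).1 (S t w).2 (D i)))
      + alpha *: nu t w.
    by rewrite /S /=; case: dp2sgd_iter.
  split.
    under eq_fun do rewrite E1.
    apply: mmxD; last first.
      by apply: mmxZ => //; apply/measurable_fun_matrixP.
    apply: mmxD => //; apply: mmxN; apply: mmxZ => //.
    apply: mmx_sum => i; apply: mclip; apply: mmxM; first exact: mmx_cst.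
    apply: mmxD; last exact: mmx_cst.
    by apply: mmxM => //; exact: mmx_cst.
  under eq_fun do rewrite E2.
  apply: mmxD; last first.
    by apply: mmxZ => //; apply/measurable_fun_matrixP.
  apply: mmxD => //; apply: mmxN; apply: mmxZ => //.
  apply: mmx_sum => i; apply: mclip; apply: mmxM.
    by apply: mmxM; [exact: mmxT|exact: mmx_cst].
  apply: mmxD; last exact: mmx_cst.
  by apply: mmxM => //; apply: mmxM => //; exact: mmx_cst.
apply: measurable_fun_pair; apply/measurable_fun_tnthP => t.
  rewrite /comp; under eq_fun do rewrite tnth_mktuple.
  by apply/measurable_fun_matrixP; exact: (mS t.+1).1.
rewrite /comp; under eq_fun do rewrite tnth_mktuple.
by apply/measurable_fun_matrixP; exact: (mS t.+1).2.
Qed.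

End measurability.

Section law.
Context {R : realType} {d : measure_display} {Omega : measurableType d}
  (P : probability Omega R) (n q p : nat) (eta alpha gamma1 gamma2 : R)
  (T : nat) (Xi : nat -> {RV P >-> 'M[R]_(q, p)})
  (nu : nat -> {RV P >-> 'cV[R]_p}).

Definition dp2sgd_output (D : @dataset R n q p) (w : Omega) :
    T.-tuple 'M[R]_(q, p) * T.-tuple 'cV[R]_p :=
  dp2sgd eta alpha gamma1 gamma2 T D (Xi ^~ w) (nu ^~ w).

HB.instance Definition _ (D : @dataset R n q p) :=
  isMeasurableFun.Build _ _ _ _ (dp2sgd_output D)
    (measurable_dp2sgd eta alpha gamma1 gamma2 D Xi nu).

Definition dp2sgd_law (D : @dataset R n q p) :
    probability (T.-tuple 'M[R]_(q, p) * T.-tuple 'cV[R]_p)%type R :=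
  distribution P (dp2sgd_output D).

End law.

(* Main.v *)
(** The randomness is a finite family z of independent centred Gaussians and the
    output for the dataset D is F_D(z). Each update is an explicit translation of
    the fresh noise by a gradient at the current state, so F_D (z - s z) = F_D' z,
    where s is the difference of the mean clipped gradients of D' and D along the
    run on D'. Since s only depends on the noise of earlier steps, integrating out
    the coordinates one by one, latest first, gives a discrete Girsanov formula:
    the density of F_D(z) with respect to F_D'(z) is
    L z = prod_i exp (s_i z_i / sg_i^2 - s_i^2 / (2 sg_i^2)), read off the output
    because F_D' is injective. Now L^a is exp (a (a-1)/2 sum_i s_i^2 / sg_i^2)
    times the same density for the shift a s, whose integral is 1, and clipping
    bounds sum_i s_i^2 / sg_i^2 by 2 rho. *)
Require Import Defs.
From HB Require Import structures.
From mathcomp Require Import all_boot all_order all_algebra.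
From mathcomp Require Import all_classical all_reals all_analysis.
From mathcomp Require Import measurable_realfun.
From mathcomp Require Import ring lra.

Set Implicit Arguments.
Unset Strict Implicit.
Unset Printing Implicit Defensive.

Import Order.TTheory GRing.Theory Num.Theory.
Import numFieldNormedType.Exports.
Local Open Scope classical_set_scope.
Local Open Scope ring_scope.

(** * Densities and the Renyi divergence *)

Section density.
Context {R : realType} {d : measure_display} {T : measurableType d}.

(** The density [g] has the same integrals over measurable sets as the Radon-Nikodym derivative, so
    both agree [mu]-almost everywhere and the change of variables carries over to [g]. *)
Lemma ge0_integral_density (mu : {sigma_finite_measure set T -> \bar R})
    (nu : {finite_measure set T -> \bar R}) (g : T -> R) (f : T -> \bar R) :
  measurable_fun setT g -> (forall x, 0 <= g x) ->
  (forall A, measurable A -> nu A = \int[mu]_(x in A) (g x)%:E)%E ->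
  measurable_fun setT f -> (forall x, 0 <= f x)%E ->
  (\int[nu]_x f x = \int[mu]_x (f x * (g x)%:E))%E.
Proof.
move=> mg g0 nuE mf f0.
have numu : nu `<< mu.
  apply/null_content_dominatesP => A mA muA0; rewrite nuE//.
  by apply: null_set_integral => //; apply/measurable_EFinP/measurable_funTS.
rewrite -(Radon_Nikodym_SigmaFinite.change_of_variables numu)//.
have mRN := measurable_int _ (Radon_Nikodym_SigmaFinite.f_integrable numu).
apply: ae_eq_integral => //.
- exact: emeasurable_funM.
- by apply: emeasurable_funM => //; exact/measurable_EFinP.
- apply: ae_eqe_mul2l; apply: integral_ae_eq => //.
  + exact: Radon_Nikodym_SigmaFinite.f_integrable.
  + exact/measurable_EFinP.
  + by move=> A _ mA; rewrite -Radon_Nikodym_SigmaFinite.f_integral// nuE.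
Qed.

(** The existence of a density [h] forces absolute continuity, which excludes the value [+oo], and
    [h] coincides [Q]-almost everywhere with the derivative in the definition. *)
Lemma renyi_divergence_le (P Q : probability T R) (h : T -> R) (a c : R) :
  1 < a -> measurable_fun setT h -> (forall x, 0 <= h x) ->
  (forall A, measurable A -> P A = \int[Q]_(x in A) (h x)%:E)%E ->
  (\int[Q]_x (h x `^ a)%:E <= (expR c)%:E)%E ->
  (renyi_divergence a P Q <= ((a - 1)^-1 * c)%:E)%E.
Proof.
move=> a1 mh h0 PE hle.
have PQ : P `<< Q.
  apply/null_content_dominatesP => A mA muA0; rewrite PE//.
  by apply: null_set_integral => //; apply/measurable_EFinP/measurable_funTS.
rewrite /renyi_divergence asboolT//.
have mRN : measurable_fun setT
    (Radon_Nikodym (charge_of_finite_measure P) Q).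
  by apply: measurable_int; exact: Radon_Nikodym_integrable.
have -> : (\int[Q]_x poweR (Radon_Nikodym (charge_of_finite_measure P) Q x) a
          = \int[Q]_x (h x `^ a)%:E)%E.
  have RNh : ae_eq Q setT (Radon_Nikodym (charge_of_finite_measure P) Q)
      (EFin \o h).
    apply: integral_ae_eq => //.
    - exact: Radon_Nikodym_integrable.
    - exact/measurable_EFinP.
    - by move=> A _ mA; rewrite -Radon_Nikodym_integral//; exact: PE.
  apply: ae_eq_integral => //.
  - under eq_fun => x do rewrite -[X in poweR X _]fineK
      ?Radon_Nikodym_fin_num// poweR_EFin.
    apply/measurable_EFinP/(measurableT_comp (measurable_powR _)).
    exact: measurableT_comp.
  - by apply/measurable_EFinP/(measurableT_comp (measurable_powR _)).
  - by apply: filterS RNh => x /= -> //.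
rewrite EFinM lee_pmul2l ?lte_fin ?invr_gt0 ?subr_gt0//.
rewrite -[leRHS](_ : lne (expR c)%:E = c%:E)%E; last first.
  by rewrite lne_EFin ?expR_gt0// expRK.
rewrite lee_lne// in_itv/= leey andbT ?lee_fin ?expR_ge0//.
by apply: integral_ge0 => x _; rewrite lee_fin powR_ge0.
Qed.

End density.

(** * Translation of a one-dimensional Gaussian *)

Section gaussian_shift.
Context {R : realType}.
Local Notation mu := (@lebesgue_measure R).

(** Both sides are measures giving []a, b]] its length, and these values determine Lebesgue
    measure. *)
Lemma lebesgue_measure_shift (s : R) (A : set R) : measurable A ->
  mu A = mu ((fun x : R => x - s) @^-1` A).
Proof.
have ms : @measurable_fun _ _ (measurableTypeR R) (measurableTypeR R) setT
    (fun x : R => x - s) by exact: measurable_funB.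
move=> mA; rewrite -[RHS]/(pushforward mu _ A).
pose f : {mfun measurableTypeR R >-> measurableTypeR R} :=
  HB.pack (fun x : R => x - s)
    (isMeasurableFun.Build _ _ _ _ _ ms).
apply: (lebesgue_measure_unique (mu := pushforward mu f)) => //.
move=> _ [[a b] _ <-]; rewrite /pushforward/=.
rewrite [X in _ = mu X](_ : _ = `]a + s, b + s]%classic); last first.
  by apply/seteqP; split => x /=; rewrite !in_itv/= lerBlDr ltrBrDr.
rewrite !lebesgue_measure_itv/= !lte_fin ltrD2r; case: ifP => // _.
by rewrite -!EFinD; congr EFin; lra.
Qed.

(** For [sg] nonzero, the density at [x] of N(s, sg^2) with respect to N(0, sg^2). *)
Definition gauss_tilt (sg s x : R) : R :=
  expR (s * x / sg ^+ 2 - s ^+ 2 / (sg ^+ 2 *+ 2)).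

Lemma measurable_gauss_tilt sg d (T : measurableType d) (s x : T -> R) :
  measurable_fun setT s -> measurable_fun setT x ->
  measurable_fun setT (fun w => gauss_tilt sg (s w) (x w)).
Proof.
move=> ms mx; apply: measurableT_comp => //; apply: measurable_funB.
  by apply: measurable_funM => //; exact: measurable_funM.
by apply: measurable_funM => //; exact: measurable_funX.
Qed.

Lemma gauss_tilt_pdf sg s x : sg != 0 ->
  normal_pdf 0 sg x * gauss_tilt sg s x = normal_pdf 0 sg (x - s).
Proof.
move=> sg0; rewrite !normal_pdfE// -mulrA; congr (_ * _).
rewrite /normal_fun /gauss_tilt -expRD; congr expR.
by field.
Qed.

Lemma ge0_integral_normal (sg : R) (f : R -> \bar R) :
  measurable_fun setT f -> (forall x, 0 <= f x)%E ->
  (\int[normal_prob 0 sg]_x f x =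
   \int[mu]_x (f x * (normal_pdf 0 sg x)%:E))%E.
Proof.
move=> mf f0; apply: ge0_integral_density => //.
- exact: measurable_normal_pdf.
- by move=> x; exact: normal_pdf_ge0.
Qed.

(** The tilt turns the Gaussian density at [x] into its value at [x - s]; translation invariance of
    Lebesgue measure then removes the shift. *)
Lemma normal_shift (sg s : R) (f : R -> \bar R) : sg != 0 ->
  measurable_fun setT f -> (forall x, 0 <= f x)%E ->
  (\int[normal_prob 0 sg]_x (f (x - s)%R * (gauss_tilt sg s x)%:E) =
   \int[normal_prob 0 sg]_x f x)%E.
Proof.
move=> sg0 mf f0.
have ms : measurable_fun setT (fun x : R => x - s) by exact: measurable_funB.
have mpdf : measurable_fun setT (normal_pdf 0 sg) := measurable_normal_pdf 0 sg.
have mfs : measurable_fun setT (fun x : R => f (x - s)%R) by exact: measurableT_comp.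
rewrite !ge0_integral_normal//; last 2 first.
- by apply: emeasurable_funM => //; apply/measurable_EFinP/measurable_gauss_tilt.
- by move=> x; rewrite mule_ge0// lee_fin expR_ge0.
pose shift : measurableTypeR R -> measurableTypeR R := fun x => (x - s)%R.
have mshift : measurable_fun setT shift by exact: measurable_funB.
have E : (\int[pushforward mu shift]_x (f x * (normal_pdf 0 sg x)%:E) =
    \int[mu]_x (f (x - s)%R * (normal_pdf 0 sg (x - s)%R)%:E))%E.
  rewrite ge0_integral_pushforward//.
  - by apply: emeasurable_funM => //; exact/measurable_EFinP.
  - by move=> x _; rewrite mule_ge0// lee_fin normal_pdf_ge0.
under eq_integral => x _ do rewrite -muleA -EFinM mulrC gauss_tilt_pdf//.
rewrite -E; apply: eq_measure_integral => A mA _.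
exact/esym/lebesgue_measure_shift.
Qed.

End gaussian_shift.

(* Boxes, rather than cylinders, generate the product sigma-algebra here because
   they form a pi-system. *)
Definition boxes (R : realType) (I : Type) : set (set (I -> R)) :=
  [set [set z | forall i, B i (z i)] |
    B in [set B : I -> set R | forall i, measurable (B i)]].

Arguments boxes : clear implicits.

Notation Rvec R I := (g_sigma_algebraType (boxes R I)).

(** * Measurability for real vectors over a finite index type *)

Section vectors.
Context {R : realType} {I : finType}.
Implicit Types (z : Rvec R I) (B : I -> set R).

Lemma measurable_box B : (forall i, measurable (B i)) ->
  measurable ([set z | forall i, B i (z i)] : set (Rvec R I)).
Proof. by move=> mB; apply: sub_sigma_algebra; exists B. Qed.

Lemma boxes_setI : setI_closed (boxes R I).
Proof.
move=> _ _ [B mB <-] [C mC <-]; exists (fun i => B i `&` C i).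
  by move=> i; exact: measurableI.
apply/seteqP; split => z /= => [zBC|[zB zC] i]; last by split.
by split=> i; have [] := zBC i.
Qed.

Lemma measurable_coord i : measurable_fun setT (fun z => z i).
Proof.
move=> _ A mA; rewrite setTI.
rewrite (_ : _ @^-1` _ = [set z | forall j, (if j == i then A else setT) (z j)]).
  apply: (measurable_box (B := fun j => if j == i then A else setT)) => j.
  by case: ifP.
apply/seteqP; split => z /= => [Azi j|/(_ i)]; last by rewrite eqxx.
by case: eqP => [->|].
Qed.

Lemma measurable_fun_vec d (T : measurableType d) (f : T -> Rvec R I) :
  (forall i, measurable_fun setT (fun x => f x i)) -> measurable_fun setT f.
Proof.
move=> mf; apply: (@measurability _ _ T (Rvec R I) setT f (boxes R I)) => //.
move=> _ [_ [B mB <-] <-]; rewrite setTI.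
rewrite (_ : _ @^-1` _ = \bigcap_(i in [set: I]) ((fun x => f x i) @^-1` B i)).
  apply: fin_bigcap_measurable => // i _.
  by rewrite -[X in measurable X]setTI; exact: mf.
by apply/seteqP; split => x /= fB i => [_|]; exact: fB.
Qed.

Definition upd (k : I) (x : R) z : Rvec R I := fun i => if i == k then x else z i.

Lemma measurable_upd k d (T : measurableType d) (x : T -> R) (f : T -> Rvec R I) :
  measurable_fun setT x -> measurable_fun setT f ->
  measurable_fun setT (fun w => upd k (x w) (f w)).
Proof.
move=> mx mf; apply: measurable_fun_vec => i; rewrite /upd; case: eqP => // _.
exact: (measurableT_comp (measurable_coord i)).
Qed.

End vectors.

Lemma measurable_prod_cond (R : realType) d (T : measurableType d) (I : finType)
    (P : pred I) (h : I -> T -> R) :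
  (forall i, measurable_fun setT (h i)) ->
  measurable_fun setT (fun x => \prod_(i | P i) h i x).
Proof.
move=> mh; under eq_fun do rewrite -big_filter.
by apply: measurable_prod => i _.
Qed.

(** * Girsanov formula for independent Gaussian coordinates *)

Section gaussian_vector.
Context {R : realType} {I : finType}.
Variables (sg : I -> R) (mu : probability (Rvec R I) R).
Hypothesis muE : forall B : I -> set R, (forall i, measurable (B i)) ->
  mu [set z | forall i, B i (z i)] = (\prod_i normal_prob 0 (sg i) (B i))%E.

(** As [mu] is a product law, replacing the coordinate [k] by an independent copy preserves it. This
    is checked on boxes, which determine the measure; Tonelli's theorem then isolates the new
    coordinate. *)
Lemma resample k (F : Rvec R I -> \bar R) :
  measurable_fun setT F -> (forall z, 0 <= F z)%E ->
  (\int[mu]_z F z =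
   \int[mu]_z \int[normal_prob 0 (sg k)]_x F (upd k x z))%E.
Proof.
move=> mF F0.
pose N : probability (measurableTypeR R) R := normal_prob 0 (sg k).
pose phi (zx : Rvec R I * measurableTypeR R) : Rvec R I := upd k zx.2 zx.1.
have mphi : measurable_fun setT phi.
  by apply: measurable_upd; [exact: measurable_snd|exact: measurable_fst].
pose f : {mfun (Rvec R I * measurableTypeR R)%type >-> Rvec R I} :=
  HB.pack phi (isMeasurableFun.Build _ _ _ _ _ mphi).
transitivity (\int[pushforward (mu \x N)%E f]_z F z)%E.
  apply: eq_measure_integral => A mA _.
  apply: (@measure_unique _ _ (Rvec R I) (boxes R I) (fun=> setT) _ _ _ _
    mu (pushforward (mu \x N)%E f)) => //.
  - exact: boxes_setI.
  - by move=> _; exists (fun=> setT) => //; apply/seteqP; split.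
  - by rewrite bigcup_const//; exists 0%N.
  - move=> _ [B mB <-] /=; rewrite muE// /pushforward.
    (* Relaxing side [k] to the whole line makes the preimage of the box a rectangle; the factor
       lost under [mu] returns as the measure of [B k] under [N]. *)
    pose Bk i := if i == k then setT else B i.
    have mBk i : measurable (Bk i) by rewrite /Bk; case: ifP.
    rewrite (_ : phi @^-1` _ = [set z | forall i, Bk i (z i)] `*` B k).
      rewrite product_measure1E//; last 2 first.
      - exact: (measurable_box mBk).
      - exact: mB.
      rewrite [X in _ = (X * _)%E](_ : _ = \prod_i normal_prob 0 (sg i) (Bk i))%E;
        last exact: muE.
      rewrite /Bk.
      rewrite (bigD1 k)//= [in RHS](bigD1 k)//= eqxx probability_setT mul1e muleC.
      by congr (_ * _)%E; apply: eq_bigr => i /negbTE ->.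
    apply/seteqP; split => -[z x] /=; rewrite /Bk /phi /upd/=.
      move=> zB; split; last by have := zB k; rewrite eqxx.
      by move=> i; have := zB i; case: eqP.
    by move=> [zB xB] i; have := zB i; case: eqP => [->|].
  - by move=> _; rewrite (le_lt_trans (probability_le1 _ _))// ltry.
rewrite ge0_integral_pushforward// preimage_setT fubini_tonelli1//.
- by apply: measurableT_comp.
- by move=> x; exact: F0.
Qed.

(** Since [s] ignores the coordinate [k], it is constant in the inner integral given by [resample],
    where [normal_shift] applies. *)
Lemma shift_coord k (s : Rvec R I -> R) (F : Rvec R I -> \bar R) :
  sg k != 0 -> measurable_fun setT s -> (forall x z, s (upd k x z) = s z) ->
  measurable_fun setT F -> (forall z, 0 <= F z)%E ->
  (\int[mu]_z (F (upd k (z k - s z)%R z) * (gauss_tilt (sg k) (s z) (z k))%:E) =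
   \int[mu]_z F z)%E.
Proof.
move=> sg0 ms sk mF F0; rewrite (resample k)//; last 2 first.
- apply: emeasurable_funM.
    apply: measurableT_comp => //; apply: measurable_upd => //.
    by apply: measurable_funB => //; exact: measurable_coord.
  by apply/measurable_EFinP/measurable_gauss_tilt => //; exact: measurable_coord.
- by move=> z; rewrite mule_ge0// lee_fin expR_ge0.
rewrite [RHS](resample k)//; apply: eq_integral => z _.
rewrite -[RHS](normal_shift (s z))//; last first.
  by apply: measurableT_comp => //; apply: measurable_upd => //; exact: measurable_id.
apply: eq_integral => x _; rewrite sk; congr (F _ * (gauss_tilt _ _ _)%:E)%E.
  by apply/funext => i; rewrite /upd eqxx; case: eqP.
by rewrite /upd eqxx.
Qed.

Section girsanov.
Variables (r : I -> nat) (s : I -> Rvec R I -> R).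
Hypothesis sg0 : forall i, sg i != 0.
Hypothesis ms : forall i, measurable_fun setT (s i).
(** The rank [r] stands for time. The inequality is not strict: a shift ignores the noise of its own
    step too, so coordinates of equal rank can be removed in any order. *)
Hypothesis s_predictable : forall i k x z, (r i <= r k)%N ->
  s i (upd k x z) = s i z.

(** Induction on the size of [J], integrating out a coordinate of largest rank: no [s i] with [i] in
    [J] depends on it. *)
Lemma girsanov_set (J : {set I}) (F : Rvec R I -> \bar R) :
  measurable_fun setT F -> (forall z, 0 <= F z)%E ->
  (\int[mu]_z (F (fun i => if i \in J then (z i - s i z)%R else z i) *
      (\prod_(i in J) gauss_tilt (sg i) (s i z) (z i))%R%:E) =
   \int[mu]_z F z)%E.
Proof.
move En : #|J| => n; elim: n J En F => [|n IH] J.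
  move=> /eqP; rewrite cards_eq0 => /eqP -> F mF F0.
  apply: eq_integral => z _; rewrite big_set0 mule1; congr F.
  by apply/funext => i; rewrite inE.
move=> Jn F mF F0; have [i0 i0J] : exists i, i \in J.
  by apply/set0Pn; rewrite -cards_eq0 Jn.
pose k := [arg max_(i > i0 in J) r i]%N.
have [kJ kmax] : k \in J /\ forall j, j \in J -> (r j <= r k)%N.
  by rewrite /k; case: arg_maxnP.
have Jk : #|J :\ k| = n by apply/eqP; rewrite -eqSS -Jn (cardsD1 k J) kJ.
rewrite -(IH _ Jk F)//.
(* The integrand for [J :\ k]. Moving its coordinate [k] by [s k] and multiplying by the tilt in [k]
   yields the integrand for [J]. *)
pose G (z : Rvec R I) : \bar R :=
    (F (fun i => if i \in J :\ k then (z i - s i z)%R else z i) *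
      (\prod_(i in J :\ k) gauss_tilt (sg i) (s i z) (z i))%R%:E)%E.
have mG : measurable_fun setT G.
  apply: emeasurable_funM.
    apply: (measurableT_comp mF (g := fun z : Rvec R I =>
      (fun i => if i \in J :\ k then z i - s i z else z i) : Rvec R I)).
    apply: measurable_fun_vec => i /=.
    case: (i \in J :\ k); last exact: measurable_coord.
    by apply: measurable_funB => //; exact: measurable_coord.
  apply/measurable_EFinP; apply: measurable_prod_cond => i.
  by apply: measurable_gauss_tilt => //; exact: measurable_coord.
have G0 z : (0 <= G z)%E.
  by rewrite mule_ge0// lee_fin prodr_ge0// => i _; exact: expR_ge0.
rewrite -[RHS](shift_coord (k := k) (s := s k))//; last first.
  by move=> x z; exact: s_predictable.
apply: eq_integral => z _; rewrite /G.
have sJ i : i \in J -> s i (upd k (z k - s k z) z) = s i z.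
  by move=> iJ; rewrite s_predictable// kmax.
rewrite -muleA -EFinM; congr (F _ * _%:E)%E.
  apply/funext => i; rewrite in_setD1 /upd.
  case: (eqVneq i k) => [->|ik] /=; first by rewrite kJ.
  by case: ifP => // /sJ ->.
rewrite (big_setD1 k)//= mulrC; congr (_ * _).
apply: eq_bigr => i; rewrite in_setD1 => /andP[ik iJ].
by rewrite sJ// /upd (negbTE ik).
Qed.

Lemma girsanov (F : Rvec R I -> \bar R) :
  measurable_fun setT F -> (forall z, 0 <= F z)%E ->
  (\int[mu]_z (F (fun i => z i - s i z)%R *
      (\prod_i gauss_tilt (sg i) (s i z) (z i))%R%:E) =
   \int[mu]_z F z)%E.
Proof.
move=> mF F0; rewrite -[RHS](girsanov_set [set: I])//.
apply: eq_integral => z _; congr (F _ * _%:E)%E.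
  by apply/funext => i; rewrite inE.
by apply: eq_bigl => i; rewrite inE.
Qed.

End girsanov.
End gaussian_vector.

(** * Renyi divergence of adaptive Gaussian mechanisms *)

Section gaussian_mechanism.
Context {R : realType} {I : finType}.
Variables (sg : I -> R) (mu : probability (Rvec R I) R).
Hypothesis muE : forall B : I -> set R, (forall i, measurable (B i)) ->
  mu [set z | forall i, B i (z i)] = (\prod_i normal_prob 0 (sg i) (B i))%E.
Variables (r : I -> nat) (s : I -> Rvec R I -> R).
Hypothesis sg0 : forall i, sg i != 0.
Hypothesis ms : forall i, measurable_fun setT (s i).
Hypothesis s_predictable : forall i k x z, (r i <= r k)%N ->
  s i (upd k x z) = s i z.

Definition likelihood (z : Rvec R I) : R := \prod_i gauss_tilt (sg i) (s i z) (z i).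

Lemma measurable_likelihood : measurable_fun setT likelihood.
Proof.
apply: measurable_prod_cond => i.
by apply: measurable_gauss_tilt => //; exact: measurable_coord.
Qed.

Lemma likelihood_ge0 z : 0 <= likelihood z.
Proof. by apply: prodr_ge0 => i _; exact: expR_ge0. Qed.

Lemma likelihood_moment (a K : R) : 1 < a ->
  (forall z, \sum_i s i z ^+ 2 / sg i ^+ 2 <= K) ->
  (\int[mu]_z (likelihood z `^ a)%:E <= (expR (a * (a - 1) / 2 * K))%:E)%E.
Proof.
move=> a1 sK.
pose La (z : Rvec R I) := \prod_i gauss_tilt (sg i) (a * s i z) (z i).
have mLa : measurable_fun setT La.
  apply: measurable_prod_cond => i; apply: measurable_gauss_tilt.
    by apply: measurable_funM => //; exact: measurable_cst.
  exact: measurable_coord.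
have La0 z : 0 <= La z by apply: prodr_ge0 => i _; exact: expR_ge0.
(* Coordinatewise, [a] times the exponent of the tilt by [s] exceeds the exponent of the tilt by
   [a * s] by (a^2 - a) s^2 / (2 sg^2). *)
have LE z : likelihood z `^ a =
    expR (a * (a - 1) / 2 * \sum_i s i z ^+ 2 / sg i ^+ 2) * La z.
  rewrite /likelihood /La /gauss_tilt -!expR_sum -expRM -expRD; congr expR.
  rewrite mulr_suml mulr_sumr -big_split/=; apply: eq_bigr => i _.
  by field.
(* The shift [a * s] is again predictable, so [girsanov] applies to the constant function 1. *)
have ILa : (\int[mu]_z (La z)%:E = 1)%E.
  rewrite -[RHS](_ : \int[mu]_z (cst 1%E z) = 1)%E; last first.
    by rewrite integral_cst// mul1e; exact: probability_setT.
  rewrite -[RHS](@girsanov _ _ _ _ muE r (fun i z => a * s i z))//.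
  - by apply: eq_integral => z _; rewrite /= mul1e.
  - by move=> i; apply: measurable_funM => //; exact: measurable_cst.
  - by move=> i k x z rik; rewrite s_predictable.
apply: (@le_trans _ _
    (\int[mu]_z ((expR (a * (a - 1) / 2 * K))%:E * (La z)%:E))%E).
  apply: ge0_le_integral => //.
  - by move=> z _; rewrite lee_fin powR_ge0.
  - apply/measurable_EFinP/(measurableT_comp (measurable_powR _)).
    exact: measurable_likelihood.
  - apply/measurable_EFinP/measurable_funM => //; exact: measurable_cst.
  - move=> z _; rewrite -EFinM lee_fin LE ler_wpM2r// ler_expR ler_wpM2l//.
    by rewrite divr_ge0// mulr_ge0; lra.
rewrite ge0_integralZl//; first by rewrite ILa mule1.
- exact/measurable_EFinP.
- by move=> z _; rewrite lee_fin.
Qed.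

(** [Z] recovers the noise from an output of [F'], which makes the likelihood a function of the
    output. That it is the density of [P] with respect to [Q] is [girsanov] for the indicator of a
    preimage under [F]. *)
Lemma renyi_divergence_adaptive d (Out : measurableType d)
    (F F' : Rvec R I -> Out) (Z : Out -> Rvec R I)
    (P Q : probability Out R) (a K : R) :
  measurable_fun setT F -> measurable_fun setT F' -> measurable_fun setT Z ->
  (forall z, Z (F' z) = z) -> (forall z, F (fun i => z i - s i z) = F' z) ->
  (forall A, measurable A -> P A = mu (F @^-1` A)) ->
  (forall A, measurable A -> Q A = mu (F' @^-1` A)) ->
  (forall z, \sum_i s i z ^+ 2 / sg i ^+ 2 <= K) -> 1 < a ->
  (renyi_divergence a P Q <= (a * (K / 2))%:E)%E.
Proof.
move=> mF mF' mZ ZF' FF' PE QE sK a1.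
pose f' : {mfun Rvec R I >-> Out} :=
  HB.pack F' (isMeasurableFun.Build _ _ _ _ _ mF').
have mL : measurable_fun setT (likelihood \o Z).
  by apply: measurableT_comp => //; exact: measurable_likelihood.
have intQ A (g : Out -> \bar R) : measurable A -> measurable_fun setT g ->
    (forall x, 0 <= g x)%E ->
    (\int[Q]_(x in A) g x = \int[mu]_(z in F' @^-1` A) g (F' z))%E.
  move=> mA mg g0; transitivity (\int[pushforward mu f']_(x in A) g x)%E.
    by apply: eq_measure_integral => B mB _; exact: QE.
  by rewrite ge0_integral_pushforward//; exact: measurable_funTS.
(* The factor [a - 1] in the moment exponent cancels the normalisation of the divergence. *)
have -> : a * (K / 2) = (a - 1)^-1 * (a * (a - 1) / 2 * K).
  by field; rewrite subr_eq0 gt_eqF.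
apply: (@renyi_divergence_le _ _ _ _ _ (likelihood \o Z)) => //.
- by move=> x; exact: likelihood_ge0.
- move=> A mA; rewrite PE// intQ//; last 2 first.
  + exact/measurable_EFinP.
  + by move=> x; rewrite lee_fin likelihood_ge0.
  have mFA : measurable (F @^-1` A) by rewrite -[X in measurable X]setTI; exact: mF.
  rewrite -[LHS](_ : \int[mu]_z (\1_(F @^-1` A) z)%:E = _)%E; last first.
    by rewrite integral_indic// setIT.
  rewrite -(girsanov muE sg0 ms s_predictable); last 2 first.
  + exact/measurable_EFinP/measurable_indic.
  + by move=> z; rewrite lee_fin.
  rewrite [RHS]integral_mkcond; apply: eq_integral => z _.
  rewrite /= patchE ZF' indicE.
  rewrite (_ : (_ \in F @^-1` A) = (z \in F' @^-1` A)); last first.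
    by apply/idP/idP; rewrite !inE /= FF'.
  by case: ifP => _; rewrite ?mul1e ?mul0e.
- rewrite intQ//; last 2 first.
  + by apply/measurable_EFinP/(measurableT_comp (measurable_powR _)).
  + by move=> x; rewrite lee_fin powR_ge0.
  rewrite preimage_setT; under eq_integral => z _ do rewrite /= ZF'.
  exact: likelihood_moment.
Qed.

End gaussian_mechanism.

(** * Sensitivity of means of clipped matrices *)

Section clipping.
Context {R : realType} (m k : nat).
Implicit Types A B : 'M[R]_(m, k).

(** Clipping scales the Frobenius norm by min(1, gamma / |A|), which is at most gamma / |A|; a zero
    norm stays zero. *)
Lemma clip_sqr_le (gamma : R) A : 0 <= gamma ->
  \sum_i \sum_j clip gamma A i j ^+ 2 <= gamma ^+ 2.
Proof.
move=> g0; pose S := \sum_i \sum_j A i j ^+ 2.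
have S0 : 0 <= S by apply: sumr_ge0 => i _; apply: sumr_ge0 => j _; exact: sqr_ge0.
have frobE : frob A ^+ 2 = S by rewrite sqr_sqrtr.
have f0 : 0 <= frob A := sqrtr_ge0 _.
pose c := Num.min 1 (gamma / frob A).
have -> : \sum_i \sum_j clip gamma A i j ^+ 2 = (c * frob A) ^+ 2.
  rewrite exprMn frobE mulr_sumr; apply: eq_bigr => i _.
  by rewrite mulr_sumr; apply: eq_bigr => j _; rewrite mxE exprMn.
have c0 : 0 <= c by rewrite le_min ler01 divr_ge0.
rewrite ler_sqr ?nnegrE ?mulr_ge0//.
have [->|fN0] := eqVneq (frob A) 0; first by rewrite mulr0.
by rewrite -ler_pdivlMr ?lt0r ?fN0// ge_min lexx orbT.
Qed.

(** The constant comes from (u - v)^2 <= 2 u^2 + 2 v^2, that is (u + v)^2 >= 0, and matches the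
    squared diameter of the ball of radius [gamma]. *)
Lemma clip_dist_sqr_le (gamma : R) A B : 0 <= gamma ->
  \sum_i \sum_j (clip gamma A i j - clip gamma B i j) ^+ 2 <= 4 * gamma ^+ 2.
Proof.
move=> g0; apply: (@le_trans _ _ (\sum_i \sum_j
    (2 * clip gamma A i j ^+ 2 + 2 * clip gamma B i j ^+ 2))).
  apply: ler_sum => i _; apply: ler_sum => j _.
  by have := sqr_ge0 (clip gamma A i j + clip gamma B i j); nra.
under eq_bigr do rewrite big_split/= -!mulr_sumr.
rewrite big_split/= -!mulr_sumr.
have := clip_sqr_le A g0; have := clip_sqr_le B g0; lra.
Qed.

(** All terms cancel except those at [l], leaving 1/n times the difference of two clipped
    matrices. *)
Lemma mean_clip_sensitivity n (gamma : R) (f g : 'I_n -> 'M[R]_(m, k)) (l : 'I_n) :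
  0 <= gamma -> (forall j, j != l -> f j = g j) ->
  \sum_i \sum_j (n%:R^-1 *: (\sum_h clip gamma (f h)) -
    n%:R^-1 *: (\sum_h clip gamma (g h))) i j ^+ 2
  <= 4 * gamma ^+ 2 / n%:R ^+ 2.
Proof.
move=> g0 fg.
rewrite (bigD1 l)//= [in X in _ - X](bigD1 l)//=.
rewrite (eq_bigr (fun h => clip gamma (g h))); last by move=> h /fg ->.
rewrite -scalerBr opprD addrACA subrr addr0.
under eq_bigr => i _.
  under eq_bigr => j _ do
    rewrite mxE [X in _ * X]mxE [X in _ + X]mxE exprMn exprVn mulrC.
  rewrite -mulr_suml; over.
rewrite -mulr_suml ler_wpM2r ?invr_ge0 ?sqr_ge0//.
exact: clip_dist_sqr_le.
Qed.

End clipping.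

(** * The recursion of the algorithm and its measurability *)

Section algorithm.
Context {R : realType} {n q p : nat}.
Variables (eta alpha gamma1 gamma2 : R).
Implicit Types (D : @dataset R n q p).

(** The step size is factored out, so that an update adds [eta] times the noise minus this mean:
    gradient and noise are on the same scale. *)
Definition mean_grad1 D (Theta : 'M[R]_(q, p)) : 'M[R]_(q, p) :=
  n%:R^-1 *: \sum_i clip gamma1 (grad1 Theta (D i)).

Definition mean_grad2 D (Theta : 'M[R]_(q, p)) (beta : 'cV[R]_p) : 'cV[R]_p :=
  n%:R^-1 *: \sum_i clip gamma2 (grad2 Theta beta (D i)).

Local Notation iter := (@dp2sgd_iter R n q p eta alpha gamma1 gamma2).

Lemma dp2sgd_iterS1 D Xi nu t : (iter D Xi nu t.+1).1 =
  (iter D Xi nu t).1 - eta *: mean_grad1 D (iter D Xi nu t).1 + eta *: Xi t.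
Proof. by rewrite /mean_grad1 /=; case: dp2sgd_iter => Th be; rewrite scalerA. Qed.

Lemma dp2sgd_iterS2 D Xi nu t : (iter D Xi nu t.+1).2 =
  (iter D Xi nu t).2 - alpha *: mean_grad2 D (iter D Xi nu t).1 (iter D Xi nu t).2
  + alpha *: nu t.
Proof. by rewrite /mean_grad2 /=; case: dp2sgd_iter => Th be; rewrite scalerA. Qed.

(** The state before step [t] is built from the noise of strictly earlier steps; this is the source
    of predictability. *)
Lemma eq_dp2sgd_iter D Xi Xi' nu nu' t :
  (forall k, (k < t)%N -> Xi k = Xi' k) -> (forall k, (k < t)%N -> nu k = nu' k) ->
  iter D Xi nu t = iter D Xi' nu' t.
Proof.
elim: t => // t IH Xit nut /=; rewrite IH.
- by case: dp2sgd_iter => Th be; rewrite Xit// nut.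
- by move=> k kt; rewrite Xit// ltnW.
- by move=> k kt; rewrite nut// ltnW.
Qed.

Section measurability.
Context {d : measure_display} {Omega : measurableType d}.

Lemma measurable_mxD m k (f g : Omega -> 'M[R]_(m, k)) :
  measurable_fun setT f -> measurable_fun setT g ->
  measurable_fun setT (fun w => f w + g w).
Proof.
move=> /measurable_fun_matrixP mf /measurable_fun_matrixP mg.
apply/measurable_fun_matrixP => i j; under eq_fun do rewrite mxE.
exact: measurable_funD.
Qed.

Lemma measurable_mxZ m k (c : R) (f : Omega -> 'M[R]_(m, k)) :
  measurable_fun setT f -> measurable_fun setT (fun w => c *: f w).
Proof.
move=> /measurable_fun_matrixP mf.
apply/measurable_fun_matrixP => i j; under eq_fun do rewrite mxE.
by apply: measurable_funM => //; exact: measurable_cst.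
Qed.

(** The state after [t.+1] steps is the last entry of the output with horizon [t.+1]; the initial
    state is not part of any output and is treated apart. *)
Lemma measurable_dp2sgd_iter D (Xi : nat -> Omega -> 'M[R]_(q, p))
    (nu : nat -> Omega -> 'cV[R]_p) t :
  (forall k, measurable_fun setT (Xi k)) -> (forall k, measurable_fun setT (nu k)) ->
  measurable_fun setT (fun w => (iter D (Xi ^~ w) (nu ^~ w) t).1) /\
  measurable_fun setT (fun w => (iter D (Xi ^~ w) (nu ^~ w) t).2).
Proof.
move=> mXi mnu; case: t => [|t]; first by split; exact: measurable_cst.
pose Xi' k : {mfun Omega >-> 'M[R]_(q, p)} :=
  HB.pack (Xi k) (isMeasurableFun.Build _ _ _ _ _ (mXi k)).
pose nu' k : {mfun Omega >-> 'cV[R]_p} :=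
  HB.pack (nu k) (isMeasurableFun.Build _ _ _ _ _ (mnu k)).
have mo := measurable_dp2sgd eta alpha gamma1 gamma2 (T := t.+1) D Xi' nu'.
have [/measurable_fun_tnthP/(_ ord_max) m1 /measurable_fun_tnthP/(_ ord_max) m2] :=
  (measurableT_comp measurable_fst mo, measurableT_comp measurable_snd mo).
split.
- by apply: eq_measurable_fun m1 => w _; rewrite /= tnth_mktuple.
- by apply: eq_measurable_fun m2 => w _; rewrite /= tnth_mktuple.
Qed.

(* Any pair (Theta, beta) is the state after one step driven by suitable noise,
   so that a second, noiseless, step exposes the mean gradients at this pair. *)
Lemma measurable_mean_grad D (Theta : Omega -> 'M[R]_(q, p))
    (beta : Omega -> 'cV[R]_p) : eta != 0 -> alpha != 0 ->
  measurable_fun setT Theta -> measurable_fun setT beta ->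
  measurable_fun setT (fun w => mean_grad1 D (Theta w)) /\
  measurable_fun setT (fun w => mean_grad2 D (Theta w) (beta w)).
Proof.
move=> eta0 alpha0 mTh mbe.
pose Xi k w : 'M[R]_(q, p) :=
  if k is 0%N then eta^-1 *: Theta w + mean_grad1 D 0 else 0.
pose nu k w : 'cV[R]_p :=
  if k is 0%N then alpha^-1 *: beta w + mean_grad2 D 0 0 else 0.
have mXi k : measurable_fun setT (Xi k).
  case: k => [|k]; last exact: measurable_cst.
  by apply: measurable_mxD; [exact: measurable_mxZ|exact: measurable_cst].
have mnu k : measurable_fun setT (nu k).
  case: k => [|k]; last exact: measurable_cst.
  by apply: measurable_mxD; [exact: measurable_mxZ|exact: measurable_cst].
have [m1 m2] := measurable_dp2sgd_iter D 2 mXi mnu.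
have E w : iter D (Xi ^~ w) (nu ^~ w) 1 = (Theta w, beta w).
  rewrite [LHS]surjective_pairing dp2sgd_iterS1 dp2sgd_iterS2 /=.
  rewrite !sub0r !scalerDr !scalerA !mulfV// !scale1r.
  by congr pair; rewrite addrCA addNr addr0.
split.
- have := measurable_mxZ (eta^-1)
    (measurable_mxD mTh (measurable_mxZ (-1) m1)).
  apply: eq_measurable_fun => w _.
  rewrite dp2sgd_iterS1 E /= scaler0 addr0 scaleN1r opprB addrC subrK.
  by rewrite scalerA mulVf// scale1r.
- have := measurable_mxZ (alpha^-1)
    (measurable_mxD mbe (measurable_mxZ (-1) m2)).
  apply: eq_measurable_fun => w _.
  rewrite dp2sgd_iterS2 E /= scaler0 addr0 scaleN1r opprB addrC subrK.
  by rewrite scalerA mulVf// scale1r.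
Qed.

End measurability.
End algorithm.

(* inl: entries of Xi^(t), inr: entries of nu^(t). *)
Notation noise_index q p T := ('I_T * ('I_q * 'I_p + 'I_p))%type.

(** * The noise of a run as one finite vector *)

Section noise_vector.
Context {R : realType} {q p T : nat}.
Implicit Types z : Rvec R (noise_index q p T).

(** The algorithm takes noise sequences indexed by [nat], so the finite vector is extended by 0 from
    step [T] on. *)
Definition noise_at z (t : nat) (c : 'I_q * 'I_p + 'I_p) : R :=
  if insub t is Some t' then z (t', c) else 0.

Definition noise1 z t : 'M[R]_(q, p) := \matrix_(i, j) noise_at z t (inl (i, j)).
Definition noise2 z t : 'cV[R]_p := \matrix_(i, j) noise_at z t (inr i).

Definition noise_sd (lambda1 lambda2 : R) (i : noise_index q p T) : R :=
  if i.2 is inl _ then lambda1 else lambda2.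

Lemma noise_at_ord z (t : 'I_T) c : noise_at z t c = z (t, c).
Proof. by rewrite /noise_at valK. Qed.

Lemma measurable_noise_at t c : measurable_fun setT (fun z => noise_at z t c).
Proof.
rewrite /noise_at; case: insub => [t'|]; last exact: measurable_cst.
exact: measurable_coord.
Qed.

Lemma measurable_noise1 t : measurable_fun setT (fun z => noise1 z t).
Proof.
apply/measurable_fun_matrixP => i j.
have := measurable_noise_at t (inl (i, j)).
by apply: eq_measurable_fun => z _; rewrite mxE.
Qed.

Lemma measurable_noise2 t : measurable_fun setT (fun z => noise2 z t).
Proof.
apply/measurable_fun_matrixP => i j.
have := measurable_noise_at t (inr i).
by apply: eq_measurable_fun => z _; rewrite mxE.
Qed.

Lemma noise_at_upd z (i : noise_index q p T) x t c : (t < i.1)%N ->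
  noise_at (upd i x z) t c = noise_at z t c.
Proof.
rewrite /noise_at; case: insubP => // t' _ <- ti.
by rewrite /upd; case: eqP ti => // <-; rewrite ltnn.
Qed.

End noise_vector.

(** * Law of the noise vector *)

Section law.
Context {R : realType} {d : measure_display} {Omega : measurableType d}
  (P : probability Omega R) {q p T : nat} (lambda1 lambda2 : R)
  (Xi : nat -> {RV P >-> 'M[R]_(q, p)}) (nu : nat -> {RV P >-> 'cV[R]_p}).

Definition noise_vec (w : Omega) : Rvec R (noise_index q p T) := fun i =>
  match i.2 with inl ij => Xi i.1 w ij.1 ij.2 | inr j => nu i.1 w j 0 end.

Lemma measurable_noise_vec : measurable_fun setT noise_vec.
Proof.
apply: measurable_fun_vec => -[t [[i j]|j]]; rewrite /noise_vec/=.
- have /measurable_fun_matrixP : measurable_fun setT (Xi t) by [].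
  exact.
- have /measurable_fun_matrixP : measurable_fun setT (nu t) by [].
  exact.
Qed.

HB.instance Definition _ :=
  isMeasurableFun.Build _ _ _ _ noise_vec measurable_noise_vec.

Lemma isotropic_gaussian_box m k (s : R) (X : {RV P >-> 'M[R]_(m, k)})
    (B : 'I_m * 'I_k -> set R) :
  isotropic_gaussian s X -> (forall ij, measurable (B ij)) ->
  P (X @^-1` [set M | forall ij, B ij (M ij.1 ij.2)]) =
  (\prod_ij normal_prob 0 s (B ij))%E.
Proof.
move=> [indep law] mB; have := indep B mB [set: _]%SET.
under [X in _ = X -> _]eq_bigl do rewrite inE.
rewrite (eq_bigr (fun ij => normal_prob 0 s (B ij))); last first.
  by move=> -[i j] _; exact: law.
move=> <-; congr (P _); apply/seteqP; split => w /=.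
  by move=> wB ij _; exact: wB.
by move=> wB ij; apply: wB; rewrite /= inE.
Qed.

Lemma measurable_mx_box m k (B : 'I_m * 'I_k -> set R) :
  (forall ij, measurable (B ij)) ->
  measurable [set M : 'M[R]_(m, k) | forall ij, B ij (M ij.1 ij.2)].
Proof.
move=> mB; rewrite (_ : [set _ | _] = \bigcap_(ij in [set: 'I_m * 'I_k])
    ((fun M : 'M[R]_(m, k) => M ij.1 ij.2) @^-1` B ij)).
  apply: fin_bigcap_measurable => // ij _.
  apply: sub_sigma_algebra; exists ij => //; exists (B ij) => //.
  by rewrite setTI.
by apply/seteqP; split => M /= MB ij => [_|]; exact: MB.
Qed.

(** Independence is used at two levels, between the noise matrices of all steps and between the
    entries of each matrix; a box splits accordingly into one box per matrix. *)
Lemma noise_vec_box (B : noise_index q p T -> set R) :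
  dp2sgd_noise T lambda1 lambda2 Xi nu -> (forall i, measurable (B i)) ->
  distribution P noise_vec [set z | forall i, B i (z i)] =
  (\prod_i normal_prob 0 (noise_sd lambda1 lambda2 i) (B i))%E.
Proof.
move=> [gXi gnu indep] mB.
pose BXi t := [set M : 'M[R]_(q, p) | forall ij, B (t, inl ij) (M ij.1 ij.2)].
pose Bnu t := [set M : 'cV[R]_p | forall ij, B (t, inr ij.1) (M ij.1 ij.2)].
have mBXi t : measurable (BXi t).
  exact: (measurable_mx_box (B := fun ij => B (t, inl ij))).
have mBnu t : measurable (Bnu t).
  exact: (measurable_mx_box (B := fun ij => B (t, inr ij.1))).
have := indep BXi Bnu mBXi mBnu [set: _]%SET.
under [X in _ = X -> _]eq_bigl do rewrite inE.
rewrite big_sumType/= => PE.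
transitivity (\prod_(t < T) \prod_c
    normal_prob 0 (noise_sd lambda1 lambda2 (t, c)) (B (t, c)))%E; last first.
  by rewrite pair_bigA; apply: eq_bigr => -[].
under eq_bigr do rewrite big_sumType/=.
rewrite big_split/=.
rewrite (eq_bigr (fun t : 'I_T => P (Xi t @^-1` BXi t))); last first.
  move=> t _.
  by rewrite (isotropic_gaussian_box (B := fun ij => B (t, inl ij)) (gXi t _)).
rewrite [X in (_ * X)%E](eq_bigr (fun t : 'I_T => P (nu t @^-1` Bnu t))); last first.
  move=> t _.
  rewrite (isotropic_gaussian_box (B := fun ij => B (t, inr ij.1)) (gnu t _))//.
  (* A column vector is a one-column matrix, so the product over the column index has a single
     factor. *)
  rewrite -(pair_bigA _ (fun i (j : 'I_1) => normal_prob 0 lambda2 (B (t, inr i)))).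
  by apply: eq_bigr => j _; rewrite big_ord1.
rewrite -[RHS]PE; congr (P _); apply/seteqP; split => w /=.
  move=> wB [t|t] _ /=; move=> ij; first exact: (wB (t, inl ij)).
  by have := wB (t, inr ij.1); rewrite /noise_vec/= (ord1 ij.2).
move=> wB [t [ij|j]].
  by apply: (wB (inl t) _ ij); rewrite /= inE.
by apply: (wB (inr t) _ (j, 0)); rewrite /= inE.
Qed.

End law.

(** * DP-2S-GD as an adaptive Gaussian mechanism *)

Section mechanism.
Context {R : realType} {n q p T : nat}.
Variables (eta alpha gamma1 gamma2 : R).
Hypotheses (eta0 : eta != 0) (alpha0 : alpha != 0).
Implicit Types (D : @dataset R n q p) (z : Rvec R (noise_index q p T)).

Definition out_of_noise D z := dp2sgd eta alpha gamma1 gamma2 T D (noise1 z) (noise2 z).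

Definition state D z t :=
  dp2sgd_iter eta alpha gamma1 gamma2 D (noise1 z) (noise2 z) t.

Lemma measurable_state D t :
  measurable_fun setT (fun z => (state D z t).1) /\
  measurable_fun setT (fun z => (state D z t).2).
Proof.
apply: (measurable_dp2sgd_iter _ _ _ _ D t (Xi := fun t z => noise1 z t)
  (nu := fun t z => noise2 z t)).
- exact: measurable_noise1.
- exact: measurable_noise2.
Qed.

Lemma measurable_out_of_noise D : measurable_fun setT (out_of_noise D).
Proof.
apply: measurable_fun_pair; apply/measurable_fun_tnthP => t.
  have [+ _] := measurable_state D t.+1.
  by apply: eq_measurable_fun => z _; rewrite /= tnth_mktuple.
have [_] := measurable_state D t.+1.
by apply: eq_measurable_fun => z _; rewrite /= tnth_mktuple.
Qed.

(** The noise shift under which the run on [D] reproduces the run on [D']. Both gradients are taken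
    at the state of the run on [D']. *)
Definition grad_gap D D' (i : noise_index q p T) z : R :=
  let Theta := (state D' z i.1).1 in let beta := (state D' z i.1).2 in
  match i.2 with
  | inl kl => (mean_grad1 gamma1 D' Theta - mean_grad1 gamma1 D Theta) kl.1 kl.2
  | inr k => (mean_grad2 gamma2 D' Theta beta - mean_grad2 gamma2 D Theta beta) k 0
  end.

Lemma measurable_grad_gap D D' i : measurable_fun setT (grad_gap D D' i).
Proof.
have [mTh mbe] := measurable_state D' i.1.
have [m1 m2] := measurable_mean_grad gamma1 gamma2 D eta0 alpha0 mTh mbe.
have [m1' m2'] := measurable_mean_grad gamma1 gamma2 D' eta0 alpha0 mTh mbe.
have := measurable_mxD m2' (measurable_mxZ (-1) m2).
have := measurable_mxD m1' (measurable_mxZ (-1) m1).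
move: i {mTh mbe m1 m2 m1' m2'} => [t [kl|k]] /=.
- move=> /measurable_fun_matrixP /(_ kl.1 kl.2) + _.
  by apply: eq_measurable_fun => z _; rewrite /grad_gap/= scaleN1r.
- move=> _ /measurable_fun_matrixP /(_ k 0).
  by apply: eq_measurable_fun => z _; rewrite /grad_gap/= scaleN1r.
Qed.

Lemma grad_gap_predictable D D' (i k : noise_index q p T) x z : (i.1 <= k.1)%N ->
  grad_gap D D' i (upd k x z) = grad_gap D D' i z.
Proof.
move=> ik; rewrite /grad_gap (_ : state D' (upd k x z) i.1 = state D' z i.1)//.
apply: eq_dp2sgd_iter => t ti; apply/matrixP => a b; rewrite !mxE.
- by rewrite noise_at_upd// (leq_trans ti).
- by rewrite noise_at_upd// (leq_trans ti).
Qed.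

(** By induction the two runs share their state at [t]; subtracting the gap from the noise then
    replaces the mean gradient of [D] by that of [D']. *)
Lemma state_grad_gap D D' z t : (t <= T)%N ->
  state D (fun i => z i - grad_gap D D' i z) t = state D' z t.
Proof.
elim: t => // t IH tT; have {}IH := IH (ltnW tT).
rewrite [LHS]surjective_pairing [RHS]surjective_pairing.
rewrite /state !dp2sgd_iterS1 !dp2sgd_iterS2 -!/(state _ _ _) IH.
have E c : noise_at (fun i => z i - grad_gap D D' i z : R) t c =
    noise_at z t c - grad_gap D D' (Ordinal tT, c) z.
  by rewrite (noise_at_ord _ (Ordinal tT)) (noise_at_ord z (Ordinal tT)).
congr pair; rewrite -!addrA; congr (_ + _).
- apply/matrixP => a b; rewrite 7!mxE [in RHS]mxE [in RHS]mxE E /grad_gap/=.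
  rewrite !mxE; ring.
- apply/matrixP => a b; rewrite 7!mxE [in RHS]mxE [in RHS]mxE E /grad_gap/=.
  rewrite (ord1 b) !mxE; ring.
Qed.

Lemma out_of_noise_grad_gap D D' z :
  out_of_noise D (fun i => z i - grad_gap D D' i z) = out_of_noise D' z.
Proof.
by congr pair; apply: eq_from_tnth => t; rewrite !tnth_mktuple;
  rewrite -!/(state _ _ _) state_grad_gap.
Qed.

Local Notation out := (T.-tuple 'M[R]_(q, p) * T.-tuple 'cV[R]_p)%type.

(** Solves each update for its noise. Outputs start after the first step, so the initial state 0 is
    put in front: entry [i.1] of the extended list is the state before step [i.1]. *)
Definition noise_of_out D (o : out) : Rvec R (noise_index q p T) := fun i =>
  let Theta := nth 0 (0 :: o.1) i.1 in let beta := nth 0 (0 :: o.2) i.1 in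
  match i.2 with
  | inl kl => (eta^-1 *: (tnth o.1 i.1 - Theta) + mean_grad1 gamma1 D Theta) kl.1 kl.2
  | inr k => (alpha^-1 *: (tnth o.2 i.1 - beta) + mean_grad2 gamma2 D Theta beta) k 0
  end.

(** The increment of a state divided by the step size is the noise minus the mean gradient, and the
    latter is computable from the previous state. *)
Lemma noise_of_outK D z : noise_of_out D (out_of_noise D z) = z.
Proof.
apply/funext => -[t c]; rewrite /noise_of_out /=.
have -> : nth 0 (0 :: (out_of_noise D z).1) t = (state D z t).1.
  case: t => -[|t] tT //=.
  exact: etrans (esym (tnth_nth _ _ (Ordinal (ltnW tT)))) (tnth_mktuple _ _).
have -> : nth 0 (0 :: (out_of_noise D z).2) t = (state D z t).2.
  case: t => -[|t] tT //=.
  exact: etrans (esym (tnth_nth _ _ (Ordinal (ltnW tT)))) (tnth_mktuple _ _).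
rewrite !tnth_mktuple dp2sgd_iterS1 dp2sgd_iterS2 -!/(state _ _ _).
case: c => [kl|k].
- rewrite [_ + _ - _]addrAC [_ - _ - _]addrAC subrr add0r scalerDr scalerN.
  rewrite !(scalerA _ eta) mulVf// !scale1r.
  by rewrite addrAC addNr add0r mxE noise_at_ord -surjective_pairing.
- rewrite [_ + _ - _]addrAC [_ - _ - _]addrAC subrr add0r scalerDr scalerN.
  rewrite !(scalerA _ alpha) mulVf// !scale1r.
  by rewrite addrAC addNr add0r mxE noise_at_ord.
Qed.

Lemma measurable_noise_of_out D : measurable_fun setT (noise_of_out D).
Proof.
have mprev d' (A : measurableType d') (x0 : A) (t : 'I_T) :
    measurable_fun setT (fun s : T.-tuple A => nth x0 (x0 :: s) t).
  case: t => -[|t] tT /=; first exact: measurable_cst.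
  have := @measurable_tnth _ A _ (Ordinal (ltnW tT)).
  by apply: eq_measurable_fun => s _; rewrite (tnth_nth x0).
apply: measurable_fun_vec => -[t c]; rewrite /noise_of_out/=.
have mTh := measurableT_comp (mprev _ _ (0 : 'M[R]_(q, p)) t)
  (@measurable_fst _ _ (T.-tuple 'M[R]_(q, p)) (T.-tuple 'cV[R]_p)).
have mbe := measurableT_comp (mprev _ _ (0 : 'cV[R]_p) t)
  (@measurable_snd _ _ (T.-tuple 'M[R]_(q, p)) (T.-tuple 'cV[R]_p)).
have [m1 m2] := measurable_mean_grad gamma1 gamma2 D eta0 alpha0 mTh mbe.
case: c => [kl|k].
- have := measurable_mxD (measurable_mxZ eta^-1
    (measurable_mxD (measurableT_comp (measurable_tnth t) measurable_fst)
      (measurable_mxZ (-1) mTh))) m1.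
  move=> /measurable_fun_matrixP /(_ kl.1 kl.2).
  by apply: eq_measurable_fun => o _; rewrite /= scaleN1r.
- have := measurable_mxD (measurable_mxZ alpha^-1
    (measurable_mxD (measurableT_comp (measurable_tnth t) measurable_snd)
      (measurable_mxZ (-1) mbe))) m2.
  move=> /measurable_fun_matrixP /(_ k 0).
  by apply: eq_measurable_fun => o _; rewrite /= scaleN1r.
Qed.

(** Both gradients are taken at the same state, so at each step only the differing entry contributes
    and [mean_clip_sensitivity] applies. *)
Lemma grad_gap_bound D D' (lambda1 lambda2 : R) z : 0 <= gamma1 -> 0 <= gamma2 ->
  neighbors D D' ->
  \sum_i grad_gap D D' i z ^+ 2 / noise_sd lambda1 lambda2 i ^+ 2 <=
  2 * (2 * T%:R / n%:R ^+ 2 *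
       (gamma1 ^+ 2 / lambda1 ^+ 2 + gamma2 ^+ 2 / lambda2 ^+ 2)).
Proof.
move=> g10 g20 [l [_ Dl]]; have Dl' j : j != l -> D' j = D j by move/Dl.
(* The contribution of one step, 4 coming from [clip_dist_sqr_le]; summing over [T] steps gives the
   bound. *)
pose K := 4 * gamma1 ^+ 2 / n%:R ^+ 2 / lambda1 ^+ 2 +
          4 * gamma2 ^+ 2 / n%:R ^+ 2 / lambda2 ^+ 2.
rewrite [leRHS](_ : _ = \sum_(t < T) K); last first.
  by rewrite sumr_const card_ord -mulr_natl /K; ring.
rewrite -(pair_bigA _ (fun t c => grad_gap D D' (t, c) z ^+ 2 /
  noise_sd lambda1 lambda2 (t, c) ^+ 2))/=.
apply: ler_sum => t _; rewrite big_sumType /noise_sd/= -!mulr_suml.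
apply: lerD; rewrite ler_wpM2r ?invr_ge0 ?sqr_ge0//.
- rewrite -(pair_bigA _ (fun k l => grad_gap D D' (t, inl (k, l)) z ^+ 2))/=.
  under eq_bigr do under eq_bigr do rewrite /grad_gap/=.
  by apply: (mean_clip_sensitivity (l := l)) => // j /Dl' ->.
- under eq_bigr do rewrite /grad_gap/=.
  apply: le_trans (mean_clip_sensitivity (l := l)
    (f := fun i => grad2 (state D' z t).1 (state D' z t).2 (D' i))
    (g := fun i => grad2 (state D' z t).1 (state D' z t).2 (D i)) g20 _).
    by apply: ler_sum => k _; rewrite big_ord1.
  by move=> j /Dl' ->.
Qed.

End mechanism.

(** * The privacy guarantee *)

Lemma out_of_noise_vec (R : realType) d (Omega : measurableType d)
    (P : probability Omega R) (n q p T : nat) (eta alpha gamma1 gamma2 : R)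
    (Xi : nat -> {RV P >-> 'M[R]_(q, p)}) (nu : nat -> {RV P >-> 'cV[R]_p})
    (D : @dataset R n q p) w :
  out_of_noise eta alpha gamma1 gamma2 D (noise_vec (T := T) Xi nu w) =
  dp2sgd_output eta alpha gamma1 gamma2 T Xi nu D w.
Proof.
have E (t : 'I_T) : dp2sgd_iter eta alpha gamma1 gamma2 D
    (noise1 (noise_vec (T := T) Xi nu w)) (noise2 (noise_vec (T := T) Xi nu w)) t.+1 =
    dp2sgd_iter eta alpha gamma1 gamma2 D (Xi ^~ w) (nu ^~ w) t.+1.
  (* Only noise of steps below [T] enters, where the vector agrees with [Xi] and [nu]. *)
  apply: eq_dp2sgd_iter => k /leq_trans/(_ (ltn_ord t)) kT;
    apply/matrixP => i j; rewrite mxE (noise_at_ord _ (Ordinal kT))//.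
  by rewrite (ord1 j).
by congr pair; apply: eq_from_tnth => t; rewrite !tnth_mktuple E.
Qed.

(** The sensitivity bound yields the guarantee with [rho], which at these noise scales is half of
    [rho1 + rho2]; the guarantee with [rho1 + rho2] follows by monotonicity. *)
Theorem proposition3p1 (R : realType) (n q p T : nat)
    (rho1 rho2 eta alpha lambda1 lambda2 gamma1 gamma2 : R)
    (d : measure_display) (Omega : measurableType d)
    (P : probability Omega R)
    (Xi : nat -> {RV P >-> 'M[R]_(q, p)}) (nu : nat -> {RV P >-> 'cV[R]_p}) :
  (0 < n)%N -> (0 < T)%N ->
  0 < rho1 -> 0 < rho2 -> 0 < eta -> 0 < alpha -> 0 < gamma1 -> 0 < gamma2 ->
  lambda1 = 2 * gamma1 / n%:R * Num.sqrt (T%:R / rho1) ->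
  lambda2 = 2 * gamma2 / n%:R * Num.sqrt (T%:R / rho2) ->
  dp2sgd_noise T lambda1 lambda2 Xi nu ->
  let M := @dp2sgd_law R d Omega P n q p eta alpha gamma1 gamma2 T Xi nu in
  let rho := 2 * T%:R / n%:R ^+ 2 *
    (gamma1 ^+ 2 / lambda1 ^+ 2 + gamma2 ^+ 2 / lambda2 ^+ 2) in
  [/\ zCDP (@neighbors (entry q p) n) M (rho1 + rho2),
      zCDP (@neighbors (entry q p) n) M rho
    & rho1 + rho2 = 2 * rho].
Proof.
move=> n0 T0 rho10 rho20 eta0 alpha0 g10 g20 lE1 lE2 noise M rho.
have n0R : 0 < n%:R :> R by rewrite ltr0n.
have T0R : 0 < T%:R :> R by rewrite ltr0n.
have l10 : 0 < lambda1.
  by rewrite lE1 mulr_gt0 ?divr_gt0 ?mulr_gt0// sqrtr_gt0 divr_gt0.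
have l20 : 0 < lambda2.
  by rewrite lE2 mulr_gt0 ?divr_gt0 ?mulr_gt0// sqrtr_gt0 divr_gt0.
have rhoE : rho1 + rho2 = 2 * rho.
  (* Here lambda1^2 = 4 gamma1^2 T / (n^2 rho1), so the first summand of [rho] is rho1 / 2, and
     likewise for the second. *)
  rewrite /rho lE1 lE2 !exprMn !sqr_sqrtr ?divr_ge0 ?ltW//.
  by field; rewrite !gt_eqF.
have rho_zcdp : zCDP (@neighbors (entry q p) n) M rho.
  (* [2 * rho] is the bound of [grad_gap_bound], taken as [K] in [renyi_divergence_adaptive]. *)
  move=> D D' DD' a a1; have -> : rho * a = a * (2 * rho / 2) by field.
  have law A (D0 : @dataset R n q p) : measurable A -> M D0 A =
      distribution P (noise_vec (T := T) Xi nu)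
        (out_of_noise eta alpha gamma1 gamma2 D0 @^-1` A).
    move=> mA; rewrite /M /dp2sgd_law /distribution /pushforward/=.
    congr (P _); apply/seteqP; split => w /=; by rewrite out_of_noise_vec.
  apply: (@renyi_divergence_adaptive R _ (noise_sd lambda1 lambda2)
    (distribution P (noise_vec (T := T) Xi nu)) _ (fun i => val i.1)
    (grad_gap eta alpha gamma1 gamma2 D D') _ _ _ _ _
    (out_of_noise eta alpha gamma1 gamma2 D)
    (out_of_noise eta alpha gamma1 gamma2 D')
    (noise_of_out eta alpha gamma1 gamma2 D')) => //.
  - by move=> B mB; exact: noise_vec_box.
  - by move=> [t [c|c]]; rewrite /noise_sd/= gt_eqF.
  - by move=> i; apply: measurable_grad_gap; rewrite gt_eqF.
  - by move=> i k x z; exact: grad_gap_predictable.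
  - exact: measurable_out_of_noise.
  - exact: measurable_out_of_noise.
  - by apply: measurable_noise_of_out; rewrite gt_eqF.
  - by move=> z; apply: noise_of_outK; rewrite gt_eqF.
  - by move=> z; exact: out_of_noise_grad_gap.
  - by move=> A; exact: law.
  - by move=> A; exact: law.
  - by move=> z; apply: grad_gap_bound => //; exact: ltW.
split=> // D D' DD' a a1; apply: le_trans (rho_zcdp D D' DD' a a1) _.
have rho_gt0 : 0 < 2 * rho by rewrite -rhoE addr_gt0.
by rewrite lee_fin rhoE ler_wpM2r; lra.
Qed.
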